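(* Let $\mathcal{D}$ be a compact $\mathrm{CAT}(0)$ space with metric $d$. In the turn-based pursuit-evasion game on $\mathcal{D}$ with one pursuer $p$ and one evader $e$, a pursuer using lion's strategy captures the evader, i.e. achieves $d(p,e)=0$, after at most $\mathrm{diam}(\mathcal{D})^2$ turns.
   Context: Game: the pursuer chooses an initial position $p^0\in\mathcal{D}$, then the evader chooses $e^0\in\mathcal{D}$. In turn $t\ge 1$ the pursuer moves from $p^{t-1}$ to a point $p^t$ with $d(p^{t-1},p^t)\le 1$; if then the pursuer and evader are at the same point the game ends with the evader captured; otherwise the evader moves from $e^{t-1}$ to a point $e^t$ with $d(e^{t-1},e^t)\le 1$. Both players have full information. In a $\mathrm{CAT}(0)$ space (a complete geodesic metric space in which every geodesic triangle is no fatter than its Euclidean comparison triangle), $\Pi(x,y)$ denotes the unique geodesic from $x$ to $y$. Lion's strategy: fix a center point $c\in\mathcal{D}$. The pursuer starts at $p^0=c$. She stays on the geodesic from $c$ to the evader: suppose her current position $p$ lies on $\Pi(c,e)$, where $e$ is the evader's position before his last move, and the evader has moved to $e'$ (in the first turn, $p=c$ and $e=e'=e^0$). If $d(p,e')\le 1$, the pursuer moves to $e'$ and captures the evader. Otherwise, letting $C=\{y\in\mathcal{D}: d(p,y)=1\}$, she moves to the point of $C\cap\Pi(c,e')$ that is closest to $e'$.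
   Formalization: The bound on the number of turns is diam(D)^2 rounded up to an integer; the unrounded bound fails, e.g. on a segment of length 1/2 with the center and the evader's start at opposite ends, where capture takes 1 turn > 1/4. *)

(* Defs.v *)
From HB Require Import structures.
From mathcomp Require Import all_boot all_order all_algebra.
From mathcomp Require Import all_classical all_reals all_analysis.

Set Implicit Arguments.
Unset Strict Implicit.
Unset Printing Implicit Defensive.

Import Order.TTheory GRing.Theory Num.Theory.

Local Open Scope classical_set_scope.
Local Open Scope ring_scope.

(* The library norm on row vectors is the sup norm, hence this definition. *)
Definition eucl_dist (R : realType) (n : nat) (u v : 'rV[R]_n) : R :=
  Num.sqrt (\sum_(i < n) (u ord0 i - v ord0 i) ^+ 2).

(* Geodesics are parametrized proportionally to arc length on [0, 1]; the
   values of [g] outside [0, 1] are irrelevant. *)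
Definition is_geodesic (R : realType) (D : metricType R) (x y : D)
    (g : R -> D) : Prop :=
  [/\ g 0 = x, g 1 = y &
      forall s t : R, 0 <= s <= 1 -> 0 <= t <= 1 ->
        mdist (g s) (g t) = `|s - t| * mdist x y].

Definition geodesic_space (R : realType) (D : metricType R) : Prop :=
  forall x y : D, exists g : R -> D, is_geodesic x y g.

(* [D] need not be pointed, so that convergence is written with an explicit
   limit. *)
Definition complete_metric (R : realType) (D : metricType R) : Prop :=
  forall F : set_system D, ProperFilter F -> cauchy F ->
    exists l : D, F --> l.

(* The triangle xb, yb, zb is a Euclidean comparison triangle of x, y, z. Two
   points of a geodesic triangle that lie on different sides lie on two sides
   issued from a common vertex, here called x; as x, y and z are arbitrary, this
   covers all pairs of sides (points of a single side are at the same distance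
   as their comparison points). The comparison points of [g s] and [h t] are the
   points dividing the corresponding Euclidean sides in the same ratio. *)
Definition thin_triangles (R : realType) (D : metricType R) : Prop :=
  forall (x y z : D) (g h k : R -> D),
    is_geodesic x y g -> is_geodesic x z h -> is_geodesic y z k ->
  forall xb yb zb : 'rV[R]_2,
    eucl_dist xb yb = mdist x y ->
    eucl_dist xb zb = mdist x z ->
    eucl_dist yb zb = mdist y z ->
  forall s t : R, 0 <= s <= 1 -> 0 <= t <= 1 ->
    mdist (g s) (h t) <=
    eucl_dist ((1 - s) *: xb + s *: yb) ((1 - t) *: xb + t *: zb).

Definition CAT0 (R : realType) (D : metricType R) : Prop :=
  [/\ complete_metric D, geodesic_space D & thin_triangles D].

(* The image of the geodesic from x to y, when it is unique; in general, the
   union of the images of all of them. *)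
Definition geodesic_path (R : realType) (D : metricType R) (x y : D) : set D :=
  [set z | exists g : R -> D, is_geodesic x y g /\
           exists2 t : R, 0 <= t <= 1 & z = g t].

Definition diameter (R : realType) (D : metricType R) : R :=
  sup [set r | exists x y : D, r = mdist x y].

Definition lion_targets (R : realType) (D : metricType R) (c p e' : D) :
    set D :=
  [set y | mdist p y = 1] `&` geodesic_path c e'.

(* The default value [p] of [xget] is taken only if no closest point exists,
   in which case the pursuer would not move. *)
Definition lion_move (R : realType) (D : metricType R) (c p e' : D) : D :=
  if mdist p e' <= 1 then e'
  else xget p [set y | lion_targets c p e' y /\
                 forall z, lion_targets c p e' z -> mdist y e' <= mdist z e'].

(* [lion_pursuer c e t] is p^t and [e t] is e^t; p^t depends on e^0, ..., e^(t-1)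
   only. *)
Fixpoint lion_pursuer (R : realType) (D : metricType R) (c : D) (e : nat -> D)
    (t : nat) : D :=
  if t is t'.+1 then lion_move c (lion_pursuer c e t') (e t') else c.

(* Turn t+1: the pursuer moves from [p t] to [p t.+1] and captures the evader if
   [p t.+1 = e t]; otherwise the evader moves from [e t] to [e t.+1]. The moves
   of the evader are constrained only as long as the game lasts. *)
Definition evader_legal (R : realType) (D : metricType R) (p e : nat -> D) :
    Prop :=
  forall t : nat, (forall s : nat, (s <= t)%N -> p s.+1 <> e s) ->
    mdist (e t) (e t.+1) <= 1.

(* d(p, e) = 0 right after the pursuer's move of turn n, when the evader is still
   at e^(n-1); for n = 0, this compares the initial positions. *)
Definition captured_after (R : realType) (D : metricType R) (p e : nat -> D)
    (n : nat) : Prop :=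
  mdist (p n) (e n.-1) = 0.

(* Main.v *)
(** Let r_t be the distance from the center c to the pursuer, and suppose that
    the evader is not within distance 1 after his move from e to e'. The
    pursuer stands at the ratio s on the geodesic from c to e, the point at the
    ratio s on the geodesic from c to e' is at distance at most s d(e,e') <= 1
    from her, and so her target is at a ratio t with s <= t < 1. The comparison
    triangle of c, e, e' turns the fact that she moves by exactly 1 into
    r_(t+1)^2 >= r_t^2 + 1. Hence r_n^2 >= n as long as the evader is free, while
    r_n < d(c,e^(n-1)) <= diam(D). *)

Require Import Defs.
From mathcomp Require Import all_boot all_order all_algebra.
From mathcomp Require Import all_classical all_reals all_analysis.
From mathcomp Require Import ring lra.
Import Order.TTheory GRing.Theory Num.Theory.
Import numFieldNormedType.Exports.
Local Open Scope classical_set_scope.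
Local Open Scope ring_scope.

(** * Comparison triangles and the CAT(0) inequality *)

Definition vec2 (R : realType) (u v : R) : 'rV[R]_2 :=
  \row_(i < 2) (if i == ord0 then u else v).

Lemma eucl_dist_vec2 (R : realType) (u v u' v' : R) :
  eucl_dist (vec2 R u v) (vec2 R u' v') =
  Num.sqrt ((u - u') ^+ 2 + (v - v') ^+ 2).
Proof.
by rewrite /eucl_dist !big_ord_recl big_ord0 !mxE /= addr0.
Qed.

Lemma vec2_lin (R : realType) (k l u v u' v' : R) :
  k *: vec2 R u v + l *: vec2 R u' v' =
  vec2 R (k * u + l * u') (k * v + l * v').
Proof. by apply/rowP => i; rewrite !mxE; case: ifP. Qed.

(* The triangle has the vertices (0, 0), (a, 0) and (u, v); the first equation is
   the law of cosines. *)
Lemma comparison_triangle (R : realType) (a b d : R) :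
  0 <= a -> 0 <= b -> 0 <= d -> a <= b + d -> b <= a + d -> d <= a + b ->
  exists u v : R,
    2 * a * u = a ^+ 2 + b ^+ 2 - d ^+ 2 /\ u ^+ 2 + v ^+ 2 = b ^+ 2.
Proof.
move=> a0 b0 d0 abd bad dab.
suff [u [uE ub]] : exists u,
    2 * a * u = a ^+ 2 + b ^+ 2 - d ^+ 2 /\ u ^+ 2 <= b ^+ 2.
  exists u, (Num.sqrt (b ^+ 2 - u ^+ 2)); split=> //.
  by rewrite sqr_sqrtr ?subr_ge0// addrC subrK.
have [a_eq0|aN0] := eqVneq a 0.
  have -> : b = d by lra.
  by exists 0; rewrite a_eq0 mulr0 expr0n /= add0r subrr sqr_ge0.
have {aN0} a_gt0 : 0 < a by rewrite lt_neqAle eq_sym aN0.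
have a2_gt0 : 0 < 2 * a by rewrite mulr_gt0.
exists ((a ^+ 2 + b ^+ 2 - d ^+ 2) / (2 * a)); split.
  by rewrite mulrC divfK// gt_eqF.
(* This amounts to (a - b)^2 <= d^2 <= (a + b)^2, that is, to the triangle inequalities. *)
rewrite -ler_sqrt ?sqr_ge0// !sqrtr_sqr.
rewrite (ger0_norm b0) ler_norml ler_pdivlMr// ler_pdivrMr//.
by apply/andP; split; nra.
Qed.

(** With vertices at (0, 0), (a, 0) and (u, v), the right-hand side is the squared Euclidean
    distance of the comparison points s (a, 0) and t (u, v), their inner product being given by the
    law of cosines. *)
Lemma CAT0_dist (R : realType) (D : metricType R) (x y z : D) (g h : R -> D)
    (s t : R) :
  CAT0 D -> is_geodesic x y g -> is_geodesic x z h ->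
  0 <= s <= 1 -> 0 <= t <= 1 ->
  mdist (g s) (h t) ^+ 2 <=
  s ^+ 2 * mdist x y ^+ 2 + t ^+ 2 * mdist x z ^+ 2 -
  s * t * (mdist x y ^+ 2 + mdist x z ^+ 2 - mdist y z ^+ 2).
Proof.
move=> [_ geoD thinD] gxy hxz s01 t01.
have [k kyz] := geoD y z.
set a := mdist x y; set b := mdist x z; set d := mdist y z.
have [] := @comparison_triangle R a b d; rewrite ?mdist_ge0//.
- by rewrite /d (metric_sym y z); exact: metric_triangle.
- exact: metric_triangle.
- by rewrite /a (metric_sym x y); exact: metric_triangle.
move=> u [v [uE vE]].
have := thinD _ _ _ _ _ _ gxy hxz kyz (vec2 R 0 0) (vec2 R a 0) (vec2 R u v).
rewrite !eucl_dist_vec2.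
have -> : Num.sqrt ((0 - a) ^+ 2 + (0 - 0) ^+ 2) = a.
  by rewrite subrr expr0n addr0 sub0r sqrrN sqrtr_sqr ger0_norm// mdist_ge0.
have -> : Num.sqrt ((0 - u) ^+ 2 + (0 - v) ^+ 2) = b.
  by rewrite !sub0r !sqrrN vE sqrtr_sqr ger0_norm// mdist_ge0.
have -> : Num.sqrt ((a - u) ^+ 2 + (0 - v) ^+ 2) = d.
  have -> : (a - u) ^+ 2 + (0 - v) ^+ 2 = d ^+ 2.
    transitivity (a ^+ 2 - 2 * a * u + (u ^+ 2 + v ^+ 2)); first by ring.
    by rewrite uE vE; ring.
  by rewrite sqrtr_sqr ger0_norm// mdist_ge0.
move=> /(_ erefl erefl erefl s t s01 t01).
rewrite !vec2_lin eucl_dist_vec2 => dle.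
rewrite -uE -vE.
have -> : s ^+ 2 * a ^+ 2 + t ^+ 2 * (u ^+ 2 + v ^+ 2) - s * t * (2 * a * u) =
    (s * a - t * u) ^+ 2 + (t * v) ^+ 2 by ring.
rewrite -[leRHS]sqr_sqrtr ?addr_ge0 ?sqr_ge0//.
rewrite ler_pXn2r ?nnegrE ?sqrtr_ge0 ?mdist_ge0//.
apply: le_trans dle _; rewrite ler_wsqrtr//; lra.
Qed.

(** The two geodesics are sides of the degenerate triangle x, y, y; at equal ratios the bound of
    [CAT0_dist] vanishes. *)
Lemma CAT0_geodesic_uniq (R : realType) (D : metricType R) (x y : D)
    (g h : R -> D) (s : R) :
  CAT0 D -> is_geodesic x y g -> is_geodesic x y h -> 0 <= s <= 1 -> g s = h s.
Proof.
move=> catD gxy hxy s01; apply: mdist_positivity; apply/eqP.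
have := @CAT0_dist R D x y y g h s s catD gxy hxy s01 s01.
rewrite mdistxx => dle; rewrite -sqrf_eq0 eq_le sqr_ge0 andbT.
by apply: le_trans dle _; lra.
Qed.

(** * Real estimates for the pursuer's step *)

Lemma mdist_triangle_abs (R : realType) (D : metricType R) (p x y : D) :
  `|mdist p x - mdist p y| <= mdist x y.
Proof.
have := metric_triangle p x y; have := metric_triangle p y x.
by rewrite (metric_sym y x) ler_norml => ? ?; apply/andP; split; lra.
Qed.

(** Serves to locate the lion's target, with [f] the distance from the pursuer along a geodesic and
    [v] the step length 1. The witness is the supremum of the sublevel set. *)
Lemma lipschitz_last_crossing (R : realType) (f : R -> R) (K v s : R) :
  0 <= K ->
  (forall x y, 0 <= x <= 1 -> 0 <= y <= 1 -> `|f x - f y| <= `|x - y| * K) ->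
  0 <= s <= 1 -> f s <= v -> v < f 1 ->
  exists t, [/\ s <= t, t < 1, f t = v &
    forall x, 0 <= x <= 1 -> f x <= v -> x <= t].
Proof.
move=> K0 fK s01 fs f1.
pose S := [set x | 0 <= x <= 1 /\ f x <= v].
have S_ub : has_ubound S by exists 1 => x [] /andP[].
have S_sup : has_sup S by split=> //; exists s.
have Sle x : 0 <= x <= 1 -> f x <= v -> x <= sup S.
  by move=> x01 fx; apply: ub_le_sup.
set t := sup S in Sle.
have st : s <= t by exact: Sle.
have t1 : t <= 1 by apply: ge_sup; [exists s|move=> x [] /andP[]].
have t01 : 0 <= t <= 1 by rewrite t1 andbT (le_trans _ st)//; case/andP: s01.
have K1 : 0 < K + 1 by lra.
have ft_le : f t <= v.
  rewrite leNgt; apply/negP => vft.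
  have e0 : 0 < (f t - v) / (K + 1) by rewrite divr_gt0// subr_gt0.
  have [x [x01 fx] tx] := sup_adherent e0 S_sup.
  have xt := Sle _ x01 fx.
  have := fK _ _ t01 x01; rewrite (ger0_norm (_ : 0 <= t - x)) ?subr_ge0//.
  move=> /(le_trans (ler_norm _)) ftx.
  have : (t - x) * (K + 1) < f t - v.
    by rewrite -ltr_pdivlMr//; rewrite -/t in tx; lra.
  nra.
have {}t1 : t < 1.
  by rewrite lt_neqAle t1 andbT; apply/eqP => tE; rewrite tE leNgt f1 in ft_le.
exists t; split=> //; apply/eqP; rewrite eq_le ft_le leNgt; apply/negP => ftv.
(* A step [e] past [t] that stays in [0, 1] and keeps [f] at most [v] contradicts the choice of [t];
   [K + 1] is positive even if [K] is 0. *)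
pose e := Num.min ((v - f t) / (K + 1)) (1 - t).
have e0 : 0 < e by rewrite lt_min divr_gt0 ?subr_gt0.
have e1 : e <= 1 - t by rewrite ge_min lexx orbT.
have eK : e * (K + 1) <= v - f t by rewrite -ler_pdivlMr// ge_min lexx.
have te01 : 0 <= t + e <= 1 by apply/andP; split; case/andP: t01; lra.
have := fK _ _ te01 t01; rewrite addrAC subrr add0r (ger0_norm (ltW e0)).
move=> /(le_trans (ler_norm _)) fte.
have : t + e <= t by apply: Sle => //; nra.
lra.
Qed.

(** [A], [B], [d2] stand for the squares of d(c, e), d(c, e'), d(e, e'). Let E, E' be the comparison
    points, with c as origin, and P = s E, Q = t E'. The last hypothesis says |P - Q| >= 1, and the
    gain follows if the angle at P between Q and the direction of E is not obtuse. *)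
Lemma unit_step_gain (R : realType) (A B d2 s t : R) :
  0 <= A -> 0 <= s -> s <= t -> t < 1 -> d2 <= 1 ->
  1 <= s ^+ 2 * A + t ^+ 2 * B - s * t * (A + B - d2) ->
  s ^+ 2 * A + 1 <= t ^+ 2 * B.
Proof.
move=> A0 s0 st t1 d21 dist1.
have [s_eq0|sN0] := eqVneq s 0; first by rewrite s_eq0 in dist1 *; lra.
have s_gt0 : 0 < s by rewrite lt_neqAle eq_sym sN0.
have [ge|lt] := leP (2 * s * A) (t * (A + B - d2)).
  have : s * (2 * s * A) <= s * (t * (A + B - d2)) by rewrite ler_wpM2l.
  nra.
(* With an obtuse angle, t E would be at distance at least |P - Q| >= 1 from Q, although the square
   of that distance is [t ^+ 2 * d2], less than 1. *)
exfalso.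
have h1 : 0 <= (t - s) * (2 * s * A - t * (A + B - d2)).
  by rewrite mulr_ge0 ?subr_ge0// ltW.
have h2 : 0 <= (t - s) ^+ 2 * A by rewrite mulr_ge0// sqr_ge0.
have h3 : t ^+ 2 * d2 <= t ^+ 2 by rewrite ler_piMr// sqr_ge0.
have h4 : t ^+ 2 < 1 by rewrite expr_lt1//; lra.
have : t ^+ 2 * d2 - 1 >= (t - s) * (2 * s * A - t * (A + B - d2)) +
   (t - s) ^+ 2 * A.
  by rewrite -subr_ge0; rewrite -subr_ge0 in dist1; apply: le_trans dist1 _;
    lra.
lra.
Qed.

(** * One turn of lion's strategy *)

Lemma geodesic_start_dist (R : realType) (D : metricType R) (x y : D)
    (g : R -> D) (s : R) :
  is_geodesic x y g -> 0 <= s <= 1 -> mdist x (g s) = s * mdist x y.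
Proof.
move=> [g0 _ gd] s01; rewrite -{1}g0 gd ?lexx ?ler01//.
by rewrite sub0r normrN ger0_norm//; case/andP: s01.
Qed.

Lemma geodesic_end_dist (R : realType) (D : metricType R) (x y : D)
    (g : R -> D) (s : R) :
  is_geodesic x y g -> 0 <= s <= 1 -> mdist (g s) y = (1 - s) * mdist x y.
Proof.
move=> [_ g1 gd] s01; rewrite -{1}g1 gd ?lexx ?ler01//.
by rewrite distrC ger0_norm// subr_ge0; case/andP: s01.
Qed.

Lemma lion_move_gain (R : realType) (D : metricType R) (c e e' : D)
    (g : R -> D) (s : R) :
  CAT0 D -> is_geodesic c e g -> 0 <= s <= 1 ->
  mdist e e' <= 1 -> 1 < mdist (g s) e' ->
  exists h t, [/\ is_geodesic c e' h, 0 <= t <= 1,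
    lion_move c (g s) e' = h t &
    mdist c (g s) ^+ 2 + 1 <= mdist c (h t) ^+ 2].
Proof.
move=> catD gce s01 ee' far; have [_ geoD _] := catD.
have /andP[s0 s1] := s01.
have [h hce'] := geoD c e'; have [_ h1 hd] := hce'.
have dist_ge0 (x y : D) : 0 <= mdist x y by exact: mdist_ge0.
(* At equal ratios the bound of [CAT0_dist] collapses to (s d(e, e'))^2. *)
have near : mdist (g s) (h s) <= 1.
  have := @CAT0_dist R D _ _ _ _ _ s s catD gce hce' s01 s01.
  set X := (X in _ <= X) => dX.
  have {}dX : mdist (g s) (h s) ^+ 2 <= (s * mdist e e') ^+ 2.
    by apply: le_trans dX _; rewrite /X; lra.
  rewrite ler_pXn2r ?nnegrE ?mulr_ge0// in dX.
  by apply: le_trans dX _; rewrite mulr_ile1.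
have [||//|//||t [st t1 ft tmax]] :=
  @lipschitz_last_crossing R (fun x => mdist (g s) (h x)) (mdist c e') 1 s.
- exact: dist_ge0.
- by move=> x y x01 y01; rewrite -hd//; exact: mdist_triangle_abs.
- by rewrite h1.
have t01 : 0 <= t <= 1 by apply/andP; split; lra.
exists h, t; split=> //.
- rewrite /lion_move leNgt far /=.
  (* The distance to [e'] decreases with the ratio along [h], so the last crossing is the only
     closest target and the default of [xget] is not taken. *)
  apply: xget_unique.
    split; first by split=> //; exists h; split=> //; exists t.
    move=> z [/= dz [k [kce' [x x01 zE]]]].
    have {}zE : z = h x.
      by rewrite zE (CAT0_geodesic_uniq _ _ _ _ _ _ _ catD kce' hce').
    rewrite zE !(@geodesic_end_dist _ _ c)// ler_wpM2r// lerD2l lerN2.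
    by apply: tmax => //; rewrite -zE dz.
  move=> z [[/= dz [k [kce' [x x01 zE]]]] zmin].
  have {}zE : z = h x.
    by rewrite zE (CAT0_geodesic_uniq _ _ _ _ _ _ _ catD kce' hce').
  have xt : x <= t by apply: tmax => //; rewrite -zE dz.
  have := zmin (h t); rewrite zE !(@geodesic_end_dist _ _ c)//.
  (* Otherwise [h] would be constant on [0, 1], and [e'] within reach. *)
  have b0 : 0 < mdist c e'.
    rewrite lt_neqAle dist_ge0 andbT eq_sym; apply/eqP => b0.
    have : mdist (h s) (h 1) = 0 by rewrite hd ?ler01 ?lexx// b0 mulr0.
    by move=> /mdist_positivity hs; rewrite hs h1 leNgt far in near.
  rewrite ler_pM2r// lerD2l lerN2 => tx.
  congr h; apply/eqP; rewrite eq_le xt tx//.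
  by split=> //; exists h; split=> //; exists t.
rewrite !(@geodesic_start_dist _ _ c e g)// (@geodesic_start_dist _ _ c e' h)//.
rewrite !exprMn; apply: (@unit_step_gain R _ _ (mdist e e' ^+ 2)) => //.
- exact: sqr_ge0.
- by rewrite expr_le1.
- by apply: le_trans (@CAT0_dist R D _ _ _ _ _ s t catD gce hce' s01 t01);
    rewrite ft expr1n.
Qed.

(** * Bound on the distances and iteration over the turns *)

Lemma compact_mdist_bounded (R : realType) (D : metricType R) :
  compact [set: D] -> has_ubound [set r : R | exists x y : D, r = mdist x y].
Proof.
move=> cptD.
have [[c]|D0] := pselect (exists c : D, True); last first.
  by exists 0 => r [x]; case: D0; exists x.
have cont : continuous (mdist c : D -> R).
  move=> x; apply/cvgrPdist_lt => eps eps0; near=> y.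
  apply: le_lt_trans (mdist_triangle_abs _ _ c x y) _.
  near: y; have := @nbhsx_ballx R D x eps eps0.
  by rewrite ballEmdist.
(* A bound [M] for the distances from the single point [c] gives [M + M] for all distances. *)
have [_ [M Mub]] : has_sup ((mdist c : D -> R) @` setT).
  apply: compact_has_sup; first by exists (mdist c c), c.
  by apply: continuous_compact => //; exact: continuous_subspaceT.
exists (M + M) => _ [x [y ->]]; apply: le_trans (metric_triangle x c y) _.
by rewrite metric_sym lerD//; apply: Mub; [exists x|exists y].
Unshelve. all: by end_near. Qed.

Lemma mdist_le_diameter (R : realType) (D : metricType R) (x y : D) :
  compact [set: D] -> mdist x y <= diameter D.
Proof.
by move=> /compact_mdist_bounded /ub_le_sup; apply; exists x, y.
Qed.

(** Induction on the turns; after turn [n] the pursuer is tied to [e n.-1], the position she has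
    just answered. For [n = 0] this is the initial position of the evader, with ratio 0. *)
Lemma lion_invariant (R : realType) (D : metricType R) (c : D) (e : nat -> D)
    (n : nat) :
  CAT0 D -> evader_legal (lion_pursuer c e) e ->
  (forall m, (0 < m <= n)%N -> lion_pursuer c e m <> e m.-1) ->
  exists g s, [/\ is_geodesic c (e n.-1) g, 0 <= s <= 1,
    lion_pursuer c e n = g s & n%:R <= mdist c (g s) ^+ 2].
Proof.
move=> catD legal; elim: n => [_|n IHn free].
  have [_ geoD _] := catD; have [g gce] := geoD c (e 0%N).
  exists g, 0; have [g0 _ _] := gce.
  by split=> //; rewrite ?lexx ?ler01 ?sqr_ge0.
have [m /andP[m0 mn]|g [s [gce s01 pE rn]]] := IHn.
  by apply: free; rewrite m0 (leq_trans mn).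
have step : mdist (e n.-1) (e n) <= 1.
  (* In the first turn both positions are [e 0]; later, legality applies because no capture has
     occurred. *)
  case: n free {IHn gce pE rn} => [|n] free; first by rewrite mdistxx.
  by apply: legal => m mn; apply: (free m.+1); rewrite /= ltnS leqW.
have far : 1 < mdist (g s) (e n).
  rewrite ltNge; apply/negP => near; apply: (free n.+1); first by rewrite leqnn.
  by rewrite /= /lion_move pE near.
have [h [t [hce t01 mE gain]]] :=
  lion_move_gain _ _ _ _ _ _ _ catD gce s01 step far.
exists h, t; split=> //=; first by rewrite pE.
by apply: le_trans gain; rewrite -natr1 lerD2r.
Qed.

Theorem theorem1p1 (R : realType) (D : metricType R)
    (D_compact : compact [set: D]) (D_CAT0 : CAT0 D)
    (c : D) (e : nat -> D)
    (e_legal : evader_legal (lion_pursuer c e) e) :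
  exists n : nat,
    (n%:Z <= Num.ceil (diameter D ^+ 2))%R /\
    captured_after (lion_pursuer c e) e n.
Proof.
apply: contrapT => /forallNP free.
have ceil_ge0 : 0 <= Num.ceil (diameter D ^+ 2).
  by rewrite ceil_ge0 (lt_le_trans _ (sqr_ge0 _))// ltrN10.
(* Without capture up to turn [N], the invariant gives N <= r_N^2 < diam(D)^2, against the choice of
   [N]. *)
pose N := `|Num.ceil (diameter D ^+ 2)|%N.
have NE : N%:Z = Num.ceil (diameter D ^+ 2) by rewrite gez0_abs.
have {}free m : (m <= N)%N -> lion_pursuer c e m <> e m.-1.
  move=> mN pe; apply: (free m); split; first by rewrite -NE lez_nat.
  by rewrite /captured_after pe mdistxx.
have [m /andP[_]|g [s [gce s01 pE rN]]] :=
  lion_invariant _ _ c e N D_CAT0 e_legal.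
  exact: free.
(* Strictness matters, as diam(D)^2 may be an integer. Ratio 1, or [c] equal to [e N.-1], would put
   the pursuer on the evader. *)
have rlt : mdist c (g s) < mdist c (e N.-1).
  rewrite (geodesic_start_dist _ _ _ _ _ _ gce s01) gtr_pMl.
    rewrite lt_neqAle; case/andP: s01 => _ ->; rewrite andbT.
    apply/eqP => s1; apply: (free N) => //; rewrite pE s1.
    by case: gce.
  rewrite mdist_gt0; apply/eqP => ce; apply: (free N) => //.
  rewrite pE; apply: mdist_positivity.
  by rewrite (geodesic_end_dist _ _ _ _ _ _ gce s01) {1}ce mdistxx mulr0.
have : N%:R < diameter D ^+ 2.
  apply: le_lt_trans rN _; rewrite ltr_pXn2r ?nnegrE ?mdist_ge0//.
    exact: lt_le_trans rlt (mdist_le_diameter _ _ _ _ D_compact).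
  by apply: le_trans (mdist_le_diameter _ _ c c D_compact); rewrite mdist_ge0.
by rewrite ltNge -[N%:R]/(N%:Z%:~R) NE ceil_ge.
Qed.
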